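(* Let $n\equiv 1\pmod 4$ be a positive integer. Suppose there are positive integers $a,b,\Delta$, with $1\le b<n$ and $b\equiv 3\pmod 4$, and integers $c>0$ and $d>0$, satisfying the system of equations $$ab(ab-1)-nac=\Delta^2,\qquad (2ab-1)^2-(4na+1)d=4\Delta^2.$$ Then $$ab(ab-1)-na=\Delta^2.$$ *)

(* Defs.v *)
From mathcomp Require Import all_boot all_order all_algebra.

(* Main.v *)
Require Import Defs.
From mathcomp Require Import all_boot all_order all_algebra.
From mathcomp Require Import zify ring.
Import Order.TTheory GRing.Theory Num.Theory.
Local Open Scope ring_scope.

(* Eliminating [Delta] from the two equations gives [d - 1 = 4na(c - d)]; since
   [(4na + 1)d < (2ab - 1)^2 < (4na + 1)^2], we have [0 < d < 4na + 1], which
   forces [c = d = 1]. *)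

Theorem proposition1p13 (n a b Delta c d : int)
    (n_gt0 : 0 < n) (n_mod4 : (n = 1 %[mod 4])%Z)
    (a_gt0 : 0 < a) (b_ge1 : 1 <= b) (b_ltn : b < n)
    (b_mod4 : (b = 3 %[mod 4])%Z)
    (Delta_gt0 : 0 < Delta) (c_gt0 : 0 < c) (d_gt0 : 0 < d)
    (eq1 : a * b * (a * b - 1) - n * a * c = Delta ^+ 2)
    (eq2 : (2 * (a * b) - 1) ^+ 2 - (4 * (n * a) + 1) * d = 4 * Delta ^+ 2) :
  a * b * (a * b - 1) - n * a = Delta ^+ 2.
Proof.
have ab_gt0 : 0 < a * b by rewrite mulr_gt0 // (lt_le_trans ltr01).
have ab_lt : a * b < n * a by rewrite mulrC ltr_pM2r.
have D2_gt0 : 0 < Delta ^+ 2 by rewrite exprn_gt0.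
have dE : d - 1 = 4 * (n * a) * (c - d).
  apply/eqP; rewrite -subr_eq0; apply/eqP.
  (* Zero is split so that [eq1] expands one copy and [eq2] the other; as
     [(2ab - 1)^2 = 4ab(ab - 1) + 1], all terms in [ab] alone cancel up to the constant 1. *)
  transitivity (4 * Delta ^+ 2 - 4 * Delta ^+ 2); last by rewrite subrr.
  by rewrite -{1}eq1 -eq2; ring.
have d_lt : d < 4 * (n * a) + 1.
  have N_gt0 : 0 < 4 * (n * a) + 1 by clear -ab_gt0 ab_lt; lia.
  rewrite -(ltr_pM2l N_gt0) -expr2.
  apply: (@lt_trans _ _ ((2 * (a * b) - 1) ^+ 2)).
    by rewrite -subr_gt0 eq2 mulr_gt0.
  (* Squaring preserves the order here, since [0 < ab < na] gives [0 < 2ab - 1 < 4na + 1]. *)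
  by rewrite ltr_pXn2r ?nnegrE //; clear -ab_gt0 ab_lt; lia.
(* By [dE], [d - 1] is a multiple of [4na] lying in [[0, 4na)], so it vanishes and the cofactor
   [c - d] is 0. *)
have cd : c = d.
  have N_gt0 := lt_trans ab_gt0 ab_lt.
  by move: (n * a) N_gt0 dE d_lt d_gt0 => N; clear; nia.
have c1 : c = 1 by apply/eqP; rewrite cd -subr_eq0 dE cd subrr mulr0.
by rewrite -eq1 c1 mulr1.
Qed.
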